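(* Let $\gamma\ge 1$ and $0<v_+<1$, and let $a$, the profile $\hat v$, and $h$ be as in the context. Any eigenvalue $\lambda\in\mathbb C$ with $\operatorname{Re}\lambda\ge 0$ of the integrated eigenvalue problem $$\lambda v+v'-u'=0,\qquad \lambda u+u'-\frac{h(\hat v)}{\hat v^{\gamma+1}}\,v'=\frac{u''}{\hat v}$$ satisfies $$\operatorname{Re}(\lambda)+|\operatorname{Im}(\lambda)|\le\Big(\sqrt\gamma+\tfrac12\Big)^2 .$$
   Context: Set $v_-=1$ and $$a=v_+^\gamma\,\frac{1-v_+}{1-v_+^\gamma}.$$ The profile $\hat v:\mathbb R\to(v_+,1)$ is a (unique up to translation, strictly decreasing) solution of $\hat v'=\hat v\big(\hat v-1+a(\hat v^{-\gamma}-1)\big)$ with $\hat v(-\infty)=1$, $\hat v(+\infty)=v_+$. Define $$h(\hat v)=-\hat v^{\gamma+1}+a(\gamma-1)+(a+1)\hat v^\gamma .$$ A number $\lambda\in\mathbb C$ is an eigenvalue of the integrated problem if there is a solution $(v,u)\not\equiv(0,0)$ (complex-valued, twice continuously differentiable on $\mathbb R$) such that $v$, $u$ and their derivatives up to order two decay exponentially as $x\to\pm\infty$; here $'=d/dx$. *)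

(* Defs.v *)
From Stdlib Require Import Reals.
From Coquelicot Require Import Coquelicot.

Open Scope R_scope.

Definition a_coef (gamma vp : R) : R :=
  Rpower vp gamma * ((1 - vp) / (1 - Rpower vp gamma)).

Definition is_profile (gamma vp : R) (vhat : R -> R) : Prop :=
  (forall x : R, vp < vhat x < 1) /\
  (forall x : R,
     is_derive vhat x
       (vhat x *
        (vhat x - 1 + a_coef gamma vp * (Rpower (vhat x) (- gamma) - 1)))) /\
  is_lim vhat m_infty 1 /\
  is_lim vhat p_infty vp.

Definition h_fun (gamma vp w : R) : R :=
  - Rpower w (gamma + 1) + a_coef gamma vp * (gamma - 1)
  + (a_coef gamma vp + 1) * Rpower w gamma.

(* The derivative is with respect to the real variable: C is taken as a normed
   module over R, not over itself. *)
Definition is_C2 (f f1 f2 : R -> C) : Prop :=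
  (forall x : R, is_derive (K := R_AbsRing) (V := C_R_NormedModule) f x (f1 x)) /\
  (forall x : R, is_derive (K := R_AbsRing) (V := C_R_NormedModule) f1 x (f2 x)) /\
  (forall x : R, continuous (T := R_UniformSpace) (U := C_UniformSpace) f2 x).

Definition exp_decay (f : R -> C) : Prop :=
  exists K c M : R, 0 < c /\
    forall x : R, M <= Rabs x -> Cmod (f x) <= K * exp (- c * Rabs x).

Definition is_eigenvalue (gamma vp : R) (vhat : R -> R) (lambda : C) : Prop :=
  exists v v1 v2 u u1 u2 : R -> C,
    is_C2 v v1 v2 /\ is_C2 u u1 u2 /\
    ~ (forall x : R, v x = RtoC 0 /\ u x = RtoC 0) /\
    exp_decay v /\ exp_decay v1 /\ exp_decay v2 /\
    exp_decay u /\ exp_decay u1 /\ exp_decay u2 /\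
    (forall x : R, (lambda * v x + v1 x - u1 x = RtoC 0)%C) /\
    (forall x : R,
       (lambda * u x + u1 x
        - RtoC (h_fun gamma vp (vhat x) / Rpower (vhat x) (gamma + 1)) * v1 x
        = u2 x / RtoC (vhat x))%C).

(* Main.v *)
Require Import Defs.
From Stdlib Require Import Reals Lra.
From Coquelicot Require Import Coquelicot.

Open Scope R_scope.

(** Two energy identities are combined pointwise, before any integration.
    Pairing the momentum equation with [vhat * conj u] and applying
    [z |-> Re z + sign (Im lambda) * Im z] controls
    [(Re lambda + |Im lambda|) vhat |u|^2 + |u'|^2], up to an exact derivative,
    by the coupling with [v'].  Pairing it with [conj v'] and using the mass
    equation gives, up to an exact derivative,
    [|u'|^2 >= (1/2) (h / vhat^(gamma+1)) |v'|^2] when [Re lambda >= 0].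
    Subtracting [1 - e] times the second from the first and completing squares,
    with [h / vhat^gamma <= gamma], produces a function [B] that vanishes at both
    infinities and has
    [B' >= (Re lambda + |Im lambda| - 1/(4e) - gamma/(1-e)) vhat |u|^2].
    If the bracket is positive, [B] is monotone, hence zero, so [u = 0] and then
    [v = 0].  The optimal [e = 1/(2 sqrt gamma + 1)] gives the stated bound. *)

(** * Differentiation of real and imaginary parts *)

Lemma is_derive_Re (f : R -> C) (x : R) (l : C) :
  is_derive (K := R_AbsRing) (V := C_R_NormedModule) f x l ->
  is_derive (fun y => Re (f y)) x (Re l).
Proof.
  intros Hf.
  exact (filterdiff_comp' (U := R_NormedModule) (V := C_R_NormedModule) f
    (fst : C -> R) x _ _ Hf
    (filterdiff_linear (U := C_R_NormedModule) _
      (is_linear_fst (U := R_NormedModule) (V := R_NormedModule)))).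
Qed.

Lemma is_derive_Im (f : R -> C) (x : R) (l : C) :
  is_derive (K := R_AbsRing) (V := C_R_NormedModule) f x l ->
  is_derive (fun y => Im (f y)) x (Im l).
Proof.
  intros Hf.
  exact (filterdiff_comp' (U := R_NormedModule) (V := C_R_NormedModule) f
    (snd : C -> R) x _ _ Hf
    (filterdiff_linear (U := C_R_NormedModule) _
      (is_linear_snd (U := R_NormedModule) (V := R_NormedModule)))).
Qed.

(** * Functions tending to zero at both infinities *)

Definition vanishes (f : R -> R) : Prop :=
  forall eps : R, 0 < eps ->
    exists M : R, forall x : R, M <= Rabs x -> Rabs (f x) <= eps.

Lemma vanishes_le (f g : R -> R) :
  (forall x, Rabs (g x) <= Rabs (f x)) -> vanishes f -> vanishes g.
Proof.
  intros E Hf eps Heps; destruct (Hf eps Heps) as [M HM].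
  exists M; intros x Hx; eapply Rle_trans; [apply E | auto].
Qed.

Lemma vanishes_plus (f g : R -> R) :
  vanishes f -> vanishes g -> vanishes (fun x => f x + g x).
Proof.
  intros Hf Hg eps Heps.
  destruct (Hf (eps / 2)) as [M HM]; [lra|].
  destruct (Hg (eps / 2)) as [N HN]; [lra|].
  exists (Rmax M N); intros x Hx.
  pose proof (Rmax_l M N); pose proof (Rmax_r M N).
  specialize (HM x ltac:(lra)); specialize (HN x ltac:(lra)).
  pose proof (Rabs_triang (f x) (g x)); lra.
Qed.

Lemma vanishes_bounded_mult (K : R) (b f : R -> R) :
  (forall x, Rabs (b x) <= K) -> vanishes f -> vanishes (fun x => b x * f x).
Proof.
  intros Hb Hf eps Heps.
  assert (HK : 0 <= K) by (pose proof (Hb 0); pose proof (Rabs_pos (b 0)); lra).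
  assert (HK1 : 0 < K + 1) by lra.
  destruct (Hf (eps / (K + 1))) as [M HM]; [now apply Rdiv_lt_0_compat|].
  exists M; intros x Hx; specialize (HM x Hx).
  rewrite Rabs_mult.
  replace eps with ((K + 1) * (eps / (K + 1))) by (field; lra).
  apply Rmult_le_compat; try apply Rabs_pos; [|exact HM].
  pose proof (Hb x); lra.
Qed.

Lemma vanishes_scal (c : R) (f : R -> R) :
  vanishes f -> vanishes (fun x => c * f x).
Proof.
  apply vanishes_bounded_mult with (b := fun _ => c) (K := Rabs c).
  intros; lra.
Qed.

Lemma vanishes_minus (f g : R -> R) :
  vanishes f -> vanishes g -> vanishes (fun x => f x - g x).
Proof.
  intros Hf Hg; apply vanishes_plus; [exact Hf|].
  apply vanishes_le with (2 := Hg); intros x; rewrite Rabs_Ropp; lra.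
Qed.

Lemma vanishes_mult (f g : R -> R) :
  vanishes f -> vanishes g -> vanishes (fun x => f x * g x).
Proof.
  intros Hf Hg eps Heps.
  destruct (Hf 1) as [M HM]; [lra|].
  destruct (Hg eps Heps) as [N HN].
  exists (Rmax M N); intros x Hx.
  pose proof (Rmax_l M N); pose proof (Rmax_r M N).
  specialize (HM x ltac:(lra)); specialize (HN x ltac:(lra)).
  rewrite Rabs_mult, <- (Rmult_1_l eps).
  apply Rmult_le_compat; try apply Rabs_pos; assumption.
Qed.

(** From [1 + t <= exp t], the bound is at most [|K| / (1 + c |x|)], which gives an explicit
    threshold for [|x|]. The sign of [K] is unknown, hence the absolute value. *)
Lemma exp_decay_vanishes (f : R -> C) :
  exp_decay f -> vanishes (fun x => Cmod (f x)).
Proof.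
  intros (K & c & M & Hc & Hf) eps Heps.
  pose proof (Rle_abs K) as HK; pose proof (Rabs_pos K) as HK0.
  exists (Rmax M ((Rabs K + 1) / (c * eps))); intros x Hx.
  pose proof (Rmax_l M ((Rabs K + 1) / (c * eps))).
  pose proof (Rmax_r M ((Rabs K + 1) / (c * eps))) as HN.
  specialize (Hf x ltac:(lra)).
  rewrite Rabs_pos_eq by apply Cmod_ge_0.
  assert (Hce : 0 < c * eps) by now apply Rmult_lt_0_compat.
  assert (Hx' : Rabs K + 1 <= c * eps * Rabs x).
  { replace (Rabs K + 1) with (c * eps * ((Rabs K + 1) / (c * eps)))
      by (field; split; lra).
    apply Rmult_le_compat_l; lra. }
  replace (- c * Rabs x) with (- (c * Rabs x)) in Hf by ring.
  rewrite exp_Ropp in Hf.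
  pose proof (exp_ineq1_le (c * Rabs x)) as He.
  pose proof (exp_pos (c * Rabs x)) as Hep.
  eapply Rle_trans; [exact Hf|].
  apply (Rmult_le_reg_r (exp (c * Rabs x))); [exact Hep|].
  rewrite Rmult_assoc, Rinv_l, Rmult_1_r by lra.
  assert (eps * (1 + c * Rabs x) <= eps * exp (c * Rabs x))
    by (apply Rmult_le_compat_l; lra).
  nra.
Qed.

Lemma exp_decay_Re (f : R -> C) : exp_decay f -> vanishes (fun x => Re (f x)).
Proof.
  intros Hf; apply vanishes_le with (2 := exp_decay_vanishes f Hf); intros x.
  rewrite (Rabs_pos_eq (Cmod _)) by apply Cmod_ge_0; apply re_le_Cmod.
Qed.

Lemma exp_decay_Im (f : R -> C) : exp_decay f -> vanishes (fun x => Im (f x)).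
Proof.
  intros Hf; apply vanishes_le with (2 := exp_decay_vanishes f Hf); intros x.
  rewrite (Rabs_pos_eq (Cmod _)) by apply Cmod_ge_0.
  eapply Rle_trans; [apply Rmax_r | apply Rmax_Cmod].
Qed.

(** [B] is nondecreasing, so a positive value would persist to the right and a negative one to the
    left, against decay at that end. Hence [B] is identically zero. *)
Lemma vanishing_monotone_derive_zero (B B' : R -> R) :
  (forall x, is_derive B x (B' x)) -> (forall x, 0 <= B' x) -> vanishes B ->
  forall x, B' x = 0.
Proof.
  intros HB HB' HV.
  assert (Hmono : forall x y, x <= y -> B x <= B y).
  { intros x y Hxy.
    destruct (MVT_gen B x y B') as (c & _ & Hc).
    - intros; apply HB.
    - intros z _; apply continuity_pt_filterlim.
      apply (ex_derive_continuous B z); eexists; apply HB.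
    - pose proof (HB' c); nra. }
  assert (Hzero : forall x, B x = 0).
  { intros x; apply Rle_antisym; apply Rnot_lt_le; intros Hlt.
    - destruct (HV (B x / 2)) as [M HM]; [lra|].
      pose proof (Rmax_l x M); pose proof (Rmax_r x M).
      pose proof (Rle_abs (Rmax x M)).
      specialize (HM (Rmax x M) ltac:(lra)).
      pose proof (Rle_abs (B (Rmax x M))).
      specialize (Hmono x (Rmax x M) ltac:(lra)); lra.
    - destruct (HV (- B x / 2)) as [M HM]; [lra|].
      pose proof (Rmin_l x (- M)); pose proof (Rmin_r x (- M)).
      pose proof (Rle_abs (- Rmin x (- M))) as H1; rewrite Rabs_Ropp in H1.
      specialize (HM (Rmin x (- M)) ltac:(lra)).
      pose proof (Rle_abs (- B (Rmin x (- M)))) as H2; rewrite Rabs_Ropp in H2.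
      specialize (Hmono (Rmin x (- M)) x ltac:(lra)); lra. }
  intros x.
  rewrite <- (is_derive_unique B x (B' x) (HB x)).
  rewrite (Derive_ext B (fun _ => 0) x Hzero); apply Derive_const.
Qed.

(** * Convexity, the slope of the profile, and bounds on [h] *)

Lemma Rpower_opp_tangent (g w y : R) : 0 <= g -> 0 < w -> 0 < y ->
  Rpower w (- g) * (1 - g * (y / w - 1)) <= Rpower y (- g).
Proof.
  intros Hg Hw Hy.
  assert (Hyw : 0 < y / w) by now apply Rdiv_lt_0_compat.
  replace (Rpower y (- g)) with (Rpower w (- g) * Rpower (y / w) (- g)).
  2:{ rewrite Rpower_mult_distr by assumption; f_equal; field; lra. }
  apply Rmult_le_compat_l; [left; apply exp_pos|].
  (* With [t = y / w], two uses of [1 + z <= exp z] give [t^(-g) >= 1 - g ln t] and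
     [ln t <= t - 1]. *)
  unfold Rpower at 1.
  pose proof (exp_ineq1_le (- g * ln (y / w))) as H1.
  pose proof (exp_ineq1_le (ln (y / w))) as H2.
  rewrite exp_ln in H2 by assumption.
  nra.
Qed.

Section ProfileBounds.

Context (gamma vp : R) (hgamma : 1 <= gamma) (hvp : 0 < vp < 1).

Let a := a_coef gamma vp.

Lemma Rpower_vp_le : 0 < Rpower vp gamma <= vp.
Proof.
  split; [apply exp_pos|].
  rewrite <- (Rpower_1 vp) at 2 by lra.
  unfold Rpower.
  assert (ln vp < 0) by (rewrite <- ln_1; apply ln_increasing; lra).
  destruct (Req_dec gamma 1) as [->|]; [lra|].
  left; apply exp_increasing; nra.
Qed.

Lemma a_coef_pos : 0 < a.
Proof.
  destruct Rpower_vp_le.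
  unfold a, a_coef; apply Rmult_lt_0_compat; [lra|].
  apply Rdiv_lt_0_compat; lra.
Qed.

(* Rankine-Hugoniot: [vp] is an equilibrium of the profile equation. *)
Lemma a_coef_equilibrium : vp - 1 + a * (Rpower vp (- gamma) - 1) = 0.
Proof.
  destruct Rpower_vp_le.
  unfold a, a_coef; rewrite Rpower_Ropp; field; lra.
Qed.

(** The product is [(1 - vp) / (1 - vp^gamma)], and [vp^gamma <= vp] because [gamma >= 1]. *)
Lemma a_coef_Rpower_le : a * Rpower vp (- gamma) <= 1.
Proof.
  destruct Rpower_vp_le.
  unfold a, a_coef; rewrite Rpower_Ropp.
  replace (_ * / _) with ((1 - vp) / (1 - Rpower vp gamma)) by (field; lra).
  apply Rle_div_l; lra.
Qed.

Lemma Rpower_opp_between (w : R) : vp < w < 1 ->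
  1 <= Rpower w (- gamma) <= Rpower vp (- gamma).
Proof.
  intros Hw; split.
  - rewrite <- (Rpower_O w) by lra; unfold Rpower.
    assert (ln w < 0) by (rewrite <- ln_1; apply ln_increasing; lra).
    left; apply exp_increasing; nra.
  - unfold Rpower.
    assert (ln vp < ln w) by (apply ln_increasing; lra).
    left; apply exp_increasing; nra.
Qed.

(** The left side is convex in [w] and vanishes at [1] and at [vp]. This supplies the monotonicity
    of the profile, which [is_profile] does not assume. *)
Lemma profile_rhs_nonpos (w : R) : vp < w < 1 ->
  w - 1 + a * (Rpower w (- gamma) - 1) <= 0.
Proof.
  intros Hw.
  pose proof a_coef_pos as Ha; pose proof a_coef_equilibrium as Heq.
  pose proof (Rpower_opp_tangent gamma w 1 ltac:(lra) ltac:(lra) ltac:(lra)) as T1.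
  pose proof (Rpower_opp_tangent gamma w vp ltac:(lra) ltac:(lra) ltac:(lra)) as Tv.
  assert (E1 : Rpower 1 (- gamma) = 1)
    by (unfold Rpower; rewrite ln_1, Rmult_0_r; apply exp_0).
  rewrite E1 in T1.
  set (X := Rpower w (- gamma)) in *; set (Y := Rpower vp (- gamma)) in *.
  (* Convexity: the tangent bounds at [1] and [vp] put [X] below the chord. *)
  assert (HX : (1 - vp) * X <= (w - vp) + (1 - w) * Y).
  { replace ((1 - vp) * X) with
      ((w - vp) * (X * (1 - gamma * (1 / w - 1)))
       + (1 - w) * (X * (1 - gamma * (vp / w - 1)))) by (field; lra).
    apply Rplus_le_compat; [|apply Rmult_le_compat_l; lra].
    rewrite <- (Rmult_1_r (w - vp)) at 2; apply Rmult_le_compat_l; lra. }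
  apply (Rmult_le_reg_l (1 - vp)); [lra|].
  assert (a * ((1 - vp) * X) <= a * ((w - vp) + (1 - w) * Y))
    by (apply Rmult_le_compat_l; lra).
  nra.
Qed.

Lemma h_fun_ratio (w : R) : 0 < w ->
  h_fun gamma vp w / Rpower w (gamma + 1)
  = -1 + (a * (gamma - 1) * Rpower w (- gamma) + (a + 1)) / w.
Proof.
  intros Hw; unfold h_fun; fold a.
  rewrite Rpower_Ropp, Rpower_plus, Rpower_1 by assumption.
  assert (0 < Rpower w gamma) by apply exp_pos.
  field; lra.
Qed.

(** Multiplied by [w], the ratio is [-w + a (gamma - 1) w^(-gamma) + a + 1], positive since [w < 1].
    For the upper bound, the equilibrium relation gives [a + 1 = vp + a vp^(-gamma)]; with [w > vp]
    the whole is at most [gamma a vp^(-gamma) <= gamma]. *)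
Lemma h_fun_ratio_bounds (w : R) : vp < w < 1 ->
  0 < h_fun gamma vp w / Rpower w (gamma + 1) /\
  w * (h_fun gamma vp w / Rpower w (gamma + 1)) <= gamma.
Proof.
  intros Hw; rewrite h_fun_ratio by lra.
  pose proof a_coef_pos; pose proof a_coef_equilibrium.
  pose proof a_coef_Rpower_le.
  destruct (Rpower_opp_between w Hw) as [HX1 HXv].
  set (X := Rpower w (- gamma)) in *; set (Y := Rpower vp (- gamma)) in *.
  assert (E : w * (-1 + (a * (gamma - 1) * X + (a + 1)) / w)
              = - w + a * (gamma - 1) * X + (a + 1)) by (field; lra).
  assert (Hag : 0 <= a * (gamma - 1)) by (apply Rmult_le_pos; lra).
  split.
  - apply (Rmult_lt_reg_l w); [lra|]; rewrite E, Rmult_0_r; nra.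
  - rewrite E; nra.
Qed.

End ProfileBounds.

(** * The pointwise energy inequality *)

(* Here [w], [w'], [H] stand for the profile, its slope and [h/w^(gamma+1)];
   [v = p + iq], [u = r + is], [lambda = al + i be], and [sg] is the sign of
   [be]. *)
Lemma energy_derivative_bound (w w' H Y al be sg gamma e : R)
  (p p1 p2 q q1 q2 r r1 r2 s s1 s2 : R)
  (hw : 0 < w < 1) (hw' : w' <= 0) (hH : 0 < H) (hwH : w * H <= gamma)
  (hY : 0 <= Y) (hslope : w' / w ^ 2 = Y - H)
  (hal : 0 <= al) (hsg : sg * sg = 1) (he : 0 < e < 1)
  (hr1 : r1 = al * p - be * q + p1) (hs1 : s1 = al * q + be * p + q1)
  (hr2 : r2 = al * p1 - be * q1 + p2) (hs2 : s2 = al * q1 + be * p1 + q2)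
  (hmr : r2 = w * (al * r - be * s + r1 - H * p1))
  (hms : s2 = w * (al * s + be * r + s1 - H * q1)) :
  (al + sg * be - (1 / (4 * e) + gamma / (1 - e))) * (w * (r ^ 2 + s ^ 2)) <=
  (r2 * r + r1 * r1) + (s2 * s + s1 * s1) + sg * (s2 * r - r2 * s)
  - / 2 * (w' * (r ^ 2 + s ^ 2) + w * (2 * (r * r1 + s * s1)))
  - (1 - e) *
    (((p1 * p2 + q1 * q2) / w - w' * (p1 ^ 2 + q1 ^ 2) / (2 * w ^ 2))
     - (al * (r1 * p + r * p1 + s1 * q + s * q1)
        - be * (s1 * p + s * p1 - r1 * q - r * q1))
     + al * (2 * (p * p1 + q * q1))).
Proof.
  set (U := r ^ 2 + s ^ 2).
  assert (hU : 0 <= U) by (unfold U; nra).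
  set (V1 := p1 ^ 2 + q1 ^ 2).
  assert (hV1 : 0 <= V1) by (unfold V1; nra).
  (* [L] is [Re + sg Im] of [v' conj u], the coupling term. *)
  set (L := p1 * (r - sg * s) + q1 * (s + sg * r)).
  assert (E : (r2 * r + r1 * r1) + (s2 * s + s1 * s1) + sg * (s2 * r - r2 * s)
  - / 2 * (w' * U + w * (2 * (r * r1 + s * s1)))
  - (1 - e) *
    (((p1 * p2 + q1 * q2) / w - w' * V1 / (2 * w ^ 2))
     - (al * (r1 * p + r * p1 + s1 * q + s * q1)
        - be * (s1 * p + s * p1 - r1 * q - r * q1))
     + al * (2 * (p * p1 + q * q1)))
  = (al + sg * be) * (w * U) + (r1 ^ 2 + s1 ^ 2) - / 2 * (w' * U)
    + sg * w * (s1 * r - r1 * s) - w * H * L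
    - (1 - e) * ((r1 ^ 2 + s1 ^ 2) - 2 * al ^ 2 * (p ^ 2 + q ^ 2) - H * V1
                 - al * V1 / w - / 2 * (w' / w ^ 2) * V1)).
  { replace p2 with (r2 - (al * p1 - be * q1)) by lra.
    replace q2 with (s2 - (al * q1 + be * p1)) by lra.
    rewrite hmr, hms; rewrite hr1, hs1; unfold U, V1, L; field; lra. }
  fold U V1; rewrite E, hslope; clear E.
  set (G := (r1 ^ 2 + s1 ^ 2)).
  assert (hsg2 : sg ^ 2 = 1) by (rewrite <- hsg; ring).
  (* The share [e] of [|u'|^2] left after the subtraction absorbs the convection term. The summand
     with [1 - sg^2] is zero; it lets [field] check the square completion without knowing
     [sg^2 = 1]. *)
  assert (Hcross_u : 0 <= e * G + sg * w * (s1 * r - r1 * s) + w ^ 2 / (4 * e) * U).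
  { replace (_ + _) with
      (e * ((r1 - sg * w * s / (2 * e)) ^ 2 + (s1 + sg * w * r / (2 * e)) ^ 2)
       + (1 - sg ^ 2) * (w ^ 2 / (4 * e) * U))
      by (unfold G, U; field; lra).
    rewrite hsg2, Rminus_diag, Rmult_0_l, Rplus_0_r.
    apply Rmult_le_pos; [lra|]; apply Rplus_le_le_0_compat; apply pow2_ge_0. }
  (* By [hslope], the terms in [|v'|^2] combine to [(1 - e) / 2 * (H + Y)]; the [H] half absorbs the
     coupling [w H L]. *)
  assert (Hcross_v : 0 <= (1 - e) / 2 * V1 - w * L + w ^ 2 / (1 - e) * U).
  { replace (_ + _) with
      ((1 - e) / 2 * ((p1 - w * (r - sg * s) / (1 - e)) ^ 2
                      + (q1 - w * (s + sg * r) / (1 - e)) ^ 2)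
       + (1 - sg ^ 2) * (w ^ 2 / (2 * (1 - e)) * U))
      by (unfold V1, L, U; field; lra).
    rewrite hsg2, Rminus_diag, Rmult_0_l, Rplus_0_r.
    apply Rmult_le_pos; [lra|]; apply Rplus_le_le_0_compat; apply pow2_ge_0. }
  apply (Rmult_le_compat_l H) in Hcross_v; [|lra].
  assert (Hw2_u : w ^ 2 / (4 * e) * U <= 1 / (4 * e) * (w * U)).
  { assert (0 < / (4 * e)) by (apply Rinv_0_lt_compat; lra).
    assert (w ^ 2 * U <= w * U) by (apply Rmult_le_compat_r; nra).
    unfold Rdiv; nra. }
  assert (Hw2_H : H * (w ^ 2 / (1 - e) * U) <= gamma / (1 - e) * (w * U)).
  { assert (0 < / (1 - e)) by (apply Rinv_0_lt_compat; lra).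
    replace (H * (w ^ 2 / (1 - e) * U)) with ((w * H) * (/ (1 - e) * (w * U)))
      by (field; lra).
    unfold Rdiv; rewrite (Rmult_assoc gamma).
    apply Rmult_le_compat_r; [|exact hwH].
    apply Rmult_le_pos; [lra|]; apply Rmult_le_pos; lra. }
  (* The terms not yet used all have a favourable sign and are dropped. *)
  assert (Hslope_u : 0 <= - w' * U) by (apply Rmult_le_pos; lra).
  assert (Hmass : 0 <= (1 - e) * (2 * al ^ 2 * (p ^ 2 + q ^ 2))).
  { apply Rmult_le_pos; [lra|]; apply Rmult_le_pos; nra. }
  assert (Hdamp : 0 <= (1 - e) * (al * V1 / w)).
  { apply Rmult_le_pos; [lra|]; apply Rdiv_le_0_compat; [nra|lra]. }
  assert (HYv : 0 <= (1 - e) * (Y * V1)).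
  { apply Rmult_le_pos; [lra|]; apply Rmult_le_pos; lra. }
  lra.
Qed.

(** * From the energy inequality to the spectral bound *)

Theorem theorem5p5 (gamma vp : R) (vhat : R -> R) (lambda : C)
  (hgamma : 1 <= gamma) (hvp : 0 < vp < 1)
  (hprofile : is_profile gamma vp vhat)
  (hlambda : is_eigenvalue gamma vp vhat lambda)
  (hRe : 0 <= Re lambda) :
  Re lambda + Rabs (Im lambda) <= (sqrt gamma + 1 / 2) ^ 2.
Proof.
  destruct hprofile as (Hw & Hdw & _ & _).
  destruct hlambda as (v & v1 & v2 & u & u1 & u2 & (Dv & Dv1 & _) &
    (Du & Du1 & _) & Hnz & Ev & Ev1 & _ & Eu & Eu1 & _ & Hmass & Hmom).
  apply Rnot_lt_le; intros Hlt; apply Hnz.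
  set (al := Re lambda) in *; set (be := Im lambda) in *.
  set (H := fun x => h_fun gamma vp (vhat x) / Rpower (vhat x) (gamma + 1)).
  assert (HH : forall x, 0 < H x /\ vhat x * H x <= gamma)
    by (intros x; apply h_fun_ratio_bounds; auto).
  assert (Hmr : forall x, Re (u1 x) = al * Re (v x) - be * Im (v x) + Re (v1 x)).
  { intros x; pose proof (f_equal Re (Hmass x)) as E; cbn in E.
    unfold al, be, Re, Im in *; lra. }
  assert (Hmi : forall x, Im (u1 x) = al * Im (v x) + be * Re (v x) + Im (v1 x)).
  { intros x; pose proof (f_equal Im (Hmass x)) as E; cbn in E.
    unfold al, be, Re, Im in *; lra. }
  assert (Hur : forall x, Re (u2 x) = vhat x *
    (al * Re (u x) - be * Im (u x) + Re (u1 x) - H x * Re (v1 x))).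
  { intros x; specialize (Hw x).
    replace (u2 x) with (RtoC (vhat x) * (u2 x / RtoC (vhat x)))%C
      by (field; intros E; apply RtoC_inj in E; lra).
    rewrite <- (Hmom x); fold (H x); unfold al, be; cbn; unfold Re, Im; ring. }
  assert (Hui : forall x, Im (u2 x) = vhat x *
    (al * Im (u x) + be * Re (u x) + Im (u1 x) - H x * Im (v1 x))).
  { intros x; specialize (Hw x).
    replace (u2 x) with (RtoC (vhat x) * (u2 x / RtoC (vhat x)))%C
      by (field; intros E; apply RtoC_inj in E; lra).
    rewrite <- (Hmom x); fold (H x); unfold al, be; cbn; unfold Re, Im; ring. }
  set (p := fun x => Re (v x)); set (q := fun x => Im (v x)).
  set (p1 := fun x => Re (v1 x)); set (q1 := fun x => Im (v1 x)).
  set (p2 := fun x => Re (v2 x)); set (q2 := fun x => Im (v2 x)).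
  set (r := fun x => Re (u x)); set (s := fun x => Im (u x)).
  set (r1 := fun x => Re (u1 x)); set (s1 := fun x => Im (u1 x)).
  set (r2 := fun x => Re (u2 x)); set (s2 := fun x => Im (u2 x)).
  assert (Dp : forall x, is_derive p x (p1 x)) by (intros; now apply is_derive_Re).
  assert (Dq : forall x, is_derive q x (q1 x)) by (intros; now apply is_derive_Im).
  assert (Dp1 : forall x, is_derive p1 x (p2 x)) by (intros; now apply is_derive_Re).
  assert (Dq1 : forall x, is_derive q1 x (q2 x)) by (intros; now apply is_derive_Im).
  assert (Dr : forall x, is_derive r x (r1 x)) by (intros; now apply is_derive_Re).
  assert (Ds : forall x, is_derive s x (s1 x)) by (intros; now apply is_derive_Im).
  assert (Dr1 : forall x, is_derive r1 x (r2 x)) by (intros; now apply is_derive_Re).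
  assert (Ds1 : forall x, is_derive s1 x (s2 x)) by (intros; now apply is_derive_Im).
  (* The mass equation is differentiated once: [u'' = lambda v' + v'']. *)
  assert (Hr2 : forall x, r2 x = al * p1 x - be * q1 x + p2 x).
  { intros x; rewrite <- (is_derive_unique _ _ _ (Dr1 x)).
    rewrite (Derive_ext r1 (fun y => al * p y - be * q y + p1 y) x Hmr).
    apply is_derive_unique; auto_derive.
    - repeat split; eexists; eauto.
    - rewrite (is_derive_unique (fun y : R => p y) _ _ (Dp x)),
        (is_derive_unique (fun y : R => q y) _ _ (Dq x)),
        (is_derive_unique (fun y : R => p1 y) _ _ (Dp1 x)); ring. }
  assert (Hs2 : forall x, s2 x = al * q1 x + be * p1 x + q2 x).
  { intros x; rewrite <- (is_derive_unique _ _ _ (Ds1 x)).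
    rewrite (Derive_ext s1 (fun y => al * q y + be * p y + q1 y) x Hmi).
    apply is_derive_unique; auto_derive.
    - repeat split; eexists; eauto.
    - rewrite (is_derive_unique (fun y : R => p y) _ _ (Dp x)),
        (is_derive_unique (fun y : R => q y) _ _ (Dq x)),
        (is_derive_unique (fun y : R => q1 y) _ _ (Dq1 x)); ring. }
  (* At [be = 0] the sign is taken to be [1], so that its square is always [1]. *)
  assert (Hsg : exists sg, sg * sg = 1 /\ sg * be = Rabs be).
  { destruct (Rle_dec 0 be).
    - exists 1; rewrite Rabs_pos_eq by assumption; split; ring.
    - exists (-1); rewrite Rabs_left by lra; split; ring. }
  destruct Hsg as (sg & Hsg2 & Hsg).
  assert (Hsq : sqrt gamma * sqrt gamma = gamma) by (apply sqrt_sqrt; lra).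
  assert (Hsq1 : 1 <= sqrt gamma) by (rewrite <- sqrt_1; now apply sqrt_le_1_alt).
  (* This [e] minimises [1 / (4 e) + gamma / (1 - e)]. *)
  set (e := 1 / (2 * sqrt gamma + 1)).
  assert (He : 0 < e < 1).
  { unfold e; split; [apply Rdiv_lt_0_compat; lra|].
    apply Rlt_div_l; lra. }
  assert (Hopt : 1 / (4 * e) + gamma / (1 - e) = (sqrt gamma + 1 / 2) ^ 2).
  { unfold e; rewrite <- Hsq at 2; field; lra. }
  set (w' := fun x => vhat x *
    (vhat x - 1 + a_coef gamma vp * (Rpower (vhat x) (- gamma) - 1))) in *.
  (* In complex form, [B] is [(Re + sg Im)(u' conj u) - vhat |u|^2 / 2] minus [1 - e] times [|v'|^2
     / (2 vhat) - Re (lambda u conj v) + al |v|^2]. *)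
  set (B := fun x => r1 x * r x + s1 x * s x + sg * (s1 x * r x - r1 x * s x)
    - / 2 * vhat x * (r x * r x + s x * s x)
    - (1 - e) *
      (/ 2 * / vhat x * (p1 x * p1 x + q1 x * q1 x)
       - (al * (r x * p x + s x * q x) - be * (s x * p x - r x * q x))
       + al * (p x * p x + q x * q x))).
  set (B' := fun x => (r2 x * r x + r1 x * r1 x) + (s2 x * s x + s1 x * s1 x)
    + sg * (s2 x * r x - r2 x * s x)
    - / 2 * (w' x * (r x ^ 2 + s x ^ 2) + vhat x * (2 * (r x * r1 x + s x * s1 x)))
    - (1 - e) *
      (((p1 x * p2 x + q1 x * q2 x) / vhat x
        - w' x * (p1 x ^ 2 + q1 x ^ 2) / (2 * vhat x ^ 2))
       - (al * (r1 x * p x + r x * p1 x + s1 x * q x + s x * q1 x)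
          - be * (s1 x * p x + s x * p1 x - r1 x * q x - r x * q1 x))
       + al * (2 * (p x * p1 x + q x * q1 x)))).
  assert (DB : forall x, is_derive B x (B' x)).
  { intros x; unfold B; specialize (Hw x).
    auto_derive.
    - repeat split; try (eexists; eauto; fail); lra.
    - rewrite (is_derive_unique (fun y : R => p y) _ _ (Dp x)),
        (is_derive_unique (fun y : R => q y) _ _ (Dq x)),
        (is_derive_unique (fun y : R => p1 y) _ _ (Dp1 x)),
        (is_derive_unique (fun y : R => q1 y) _ _ (Dq1 x)),
        (is_derive_unique (fun y : R => r y) _ _ (Dr x)),
        (is_derive_unique (fun y : R => s y) _ _ (Ds x)),
        (is_derive_unique (fun y : R => r1 y) _ _ (Dr1 x)),
        (is_derive_unique (fun y : R => s1 y) _ _ (Ds1 x)),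
        (is_derive_unique (fun y : R => vhat y) _ _ (Hdw x)).
      unfold B'; fold (w' x); field; lra. }
  assert (HB : forall x, (al + Rabs be - (sqrt gamma + 1 / 2) ^ 2) *
                         (vhat x * (r x ^ 2 + s x ^ 2)) <= B' x).
  { intros x; specialize (Hw x); destruct (HH x) as [HH1 HH2].
    rewrite <- Hsg, <- Hopt.
    (* [Y] is minus the derivative of the pressure [w^(-gamma)] times [a], at [w = vhat x]; the
       profile equation then reads [w' / w^2 = Y - H]. *)
    apply energy_derivative_bound with (H := H x)
      (Y := a_coef gamma vp * gamma * Rpower (vhat x) (- gamma) / vhat x); auto.
    - lra.
    - unfold w'; pose proof (profile_rhs_nonpos gamma vp hgamma hvp _ Hw); nra.
    - pose proof (a_coef_pos gamma vp hgamma hvp).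
      apply Rdiv_le_0_compat; [|lra].
      apply Rmult_le_pos; [nra | left; apply exp_pos].
    - unfold H; rewrite h_fun_ratio by lra; unfold w'; field; lra.
    - apply Hmr.
    - apply Hmi.
    - apply Hur.
    - apply Hui. }
  assert (HV : vanishes B).
  { pose proof (exp_decay_Re _ Ev : vanishes p) as Vp.
    pose proof (exp_decay_Im _ Ev : vanishes q) as Vq.
    pose proof (exp_decay_Re _ Ev1 : vanishes p1) as Vp1.
    pose proof (exp_decay_Im _ Ev1 : vanishes q1) as Vq1.
    pose proof (exp_decay_Re _ Eu : vanishes r) as Vr.
    pose proof (exp_decay_Im _ Eu : vanishes s) as Vs.
    pose proof (exp_decay_Re _ Eu1 : vanishes r1) as Vr1.
    pose proof (exp_decay_Im _ Eu1 : vanishes s1) as Vs1.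
    assert (Bw : forall x, Rabs (/ 2 * vhat x) <= 1).
    { intros x; specialize (Hw x); rewrite Rabs_pos_eq; lra. }
    assert (Biw : forall x, Rabs (/ 2 * / vhat x) <= / 2 * / vp).
    { intros x; specialize (Hw x).
      assert (0 < / vhat x) by (apply Rinv_0_lt_compat; lra).
      assert (/ vhat x <= / vp) by (apply Rinv_le_contravar; lra).
      rewrite Rabs_pos_eq; lra. }
    unfold B.
    (* The bounded factors are tried before [vanishes_mult], which would demand that [vhat] or its
       inverse vanish at infinity. *)
    repeat first
      [ assumption
      | apply vanishes_minus | apply vanishes_plus
      | apply vanishes_scal
      | apply vanishes_bounded_mult with (1 := Bw)
      | apply vanishes_bounded_mult with (1 := Biw)
      | apply vanishes_mult ]. }
  assert (Hpos : forall x, 0 <= vhat x * (r x ^ 2 + s x ^ 2)).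
  { intros x; specialize (Hw x); apply Rmult_le_pos; [lra|nra]. }
  assert (HB0 : forall x, B' x = 0).
  { apply vanishing_monotone_derive_zero with (B := B); auto.
    intros x; eapply Rle_trans; [|apply HB]; apply Rmult_le_pos; [lra|auto]. }
  assert (Hu0 : forall x, r x = 0 /\ s x = 0).
  { intros x; specialize (HB x); rewrite HB0 in HB; specialize (Hw x).
    assert (r x ^ 2 + s x ^ 2 <= 0).
    { apply Rnot_lt_le; intros Hc.
      assert (0 < vhat x * (r x ^ 2 + s x ^ 2)) by (apply Rmult_lt_0_compat; lra).
      assert (0 < al + Rabs be - (sqrt gamma + 1 / 2) ^ 2) by lra.
      nra. }
    split; nra. }
  assert (Hu1 : forall x, r1 x = 0 /\ s1 x = 0).
  { intros x; rewrite <- (is_derive_unique _ _ _ (Dr x)),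
      <- (is_derive_unique _ _ _ (Ds x)).
    rewrite (Derive_ext r (fun _ => 0)) by apply Hu0.
    rewrite (Derive_ext s (fun _ => 0)) by apply Hu0.
    split; apply Derive_const. }
  assert (Hu2 : forall x, r2 x = 0 /\ s2 x = 0).
  { intros x; rewrite <- (is_derive_unique _ _ _ (Dr1 x)),
      <- (is_derive_unique _ _ _ (Ds1 x)).
    rewrite (Derive_ext r1 (fun _ => 0)) by apply Hu1.
    rewrite (Derive_ext s1 (fun _ => 0)) by apply Hu1.
    split; apply Derive_const. }
  intros x.
  destruct (Hu0 x) as [Er Es], (Hu1 x) as [Er1 Es1], (Hu2 x) as [Er2 Es2].
  specialize (Hur x); specialize (Hui x); specialize (Hmr x); specialize (Hmi x).
  fold (p x) (q x) (p1 x) (q1 x) (r x) (s x) (r1 x) (s1 x) (r2 x) (s2 x) in *.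
  rewrite Er, Es, Er1, Er2 in Hur; rewrite Er, Es, Es1, Es2 in Hui.
  rewrite Er1 in Hmr; rewrite Es1 in Hmi.
  specialize (Hw x); destruct (HH x) as [HH1 _].
  assert (HwH : 0 < vhat x * H x) by (apply Rmult_lt_0_compat; lra).
  (* With [u = 0] the momentum equation reduces to [vhat H v' = 0]. *)
  assert (Ep1 : p1 x = 0).
  { apply (Rmult_eq_reg_l (vhat x * H x)); lra. }
  assert (Eq1 : q1 x = 0).
  { apply (Rmult_eq_reg_l (vhat x * H x)); lra. }
  rewrite Ep1 in Hmr; rewrite Eq1 in Hmi.
  (* [lambda] is nonzero, since [al + |be|] exceeds a square. *)
  assert (Hl : 0 < al ^ 2 + be ^ 2).
  { rewrite <- (pow2_abs be).
    assert (0 < al + Rabs be) by (pose proof (pow2_ge_0 (sqrt gamma + 1 / 2)); lra).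
    pose proof (pow2_ge_0 (al - Rabs be)).
    pose proof (pow_lt (al + Rabs be) 2 ltac:(lra)); nra. }
  assert (Ep : p x = 0).
  { apply (Rmult_eq_reg_l (al ^ 2 + be ^ 2)); [|lra].
    (* This is the real part of [conj lambda * (lambda v)], and [lambda v = 0] by the mass
       equation. *)
    replace (_ * p x) with (al * (al * p x - be * q x + 0)
      + be * (al * q x + be * p x + 0)) by ring.
    rewrite <- Hmr, <- Hmi; ring. }
  assert (Eq : q x = 0).
  { apply (Rmult_eq_reg_l (al ^ 2 + be ^ 2)); [|lra].
    replace (_ * q x) with (al * (al * q x + be * p x + 0)
      - be * (al * p x - be * q x + 0)) by ring.
    rewrite <- Hmr, <- Hmi; ring. }
  split; apply injective_projections; assumption.
Qed.
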